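(* Let $\varepsilon_0\in(0,\delta)$. For every $\varepsilon\in(0,\varepsilon_0)$ let $u=u^\varepsilon$ (an $\mathbb{R}^3$-valued function) and $p=p^\varepsilon$ (a scalar function) be smooth on $\overline{Q_{\varepsilon,T}}$ and satisfy the incompressible Euler equations in the moving thin domain $\Omega_\varepsilon(t)$: $$\partial_t u+(u\cdot\nabla)u+\nabla p=0 \ \text{ in } Q_{\varepsilon,T},\qquad \mathrm{div}\,u=0\ \text{ in } Q_{\varepsilon,T},\qquad u\cdot\nu_\varepsilon=V_\varepsilon^N\ \text{ on }\partial_\ell Q_{\varepsilon,T}.$$ Suppose that $u$ and $p$ admit expansions in powers of the signed distance, with coefficients $v,v^1,q,q^1,\dots$ on $S_T$ independent of $\varepsilon$, $$u(x,t)=v(\pi(x,t),t)+d(x,t)\,v^1(\pi(x,t),t)+R(d(x,t)^2),$$ $$p(x,t)=q(\pi(x,t),t)+d(x,t)\,q^1(\pi(x,t),t)+R(d(x,t)^2).$$ Then $v\cdot\nu=V_\Gamma^N$ on $S_T$, and $v$, $q$, $q^1$ satisfy $$\partial^\bullet_v v+\nabla_\Gamma q+q^1\nu=0\quad\text{on } S_T,\qquad \mathrm{div}_\Gamma v=0\quad\text{on } S_T.$$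
   Context: Geometry. Let $T>0$ and let $\Gamma(t)$, $t\in[0,T]$, be a two-dimensional closed (compact, without boundary), connected, oriented, smooth surface in $\mathbb{R}^3$ moving smoothly in $t$ (without change of topology), with unit outward normal $\nu(\cdot,t)$ and scalar outward normal velocity $V_\Gamma^N(\cdot,t)$. Put $S_T=\bigcup_{t\in(0,T)}\Gamma(t)\times\{t\}$. Fix $\delta>0$ independent of $t$ such that every $x\in N(t)=\{x\in\mathbb{R}^3: \mathrm{dist}(x,\Gamma(t))<\delta\}$ is uniquely written as $x=\pi(x,t)+d(x,t)\nu(\pi(x,t),t)$, where $\pi(\cdot,t)$ is the closest point mapping onto $\Gamma(t)$ and $d(\cdot,t)$ is the signed distance from $\Gamma(t)$, increasing in the direction of $\nu$; $\pi$ and $d$ are smooth on the closure of $N_T=\bigcup_{t\in(0,T)}N(t)\times\{t\}$. For $0<\varepsilon<\delta$ let $\Omega_\varepsilon(t)=\{x: \mathrm{dist}(x,\Gamma(t))<\varepsilon\}$, $Q_{\varepsilon,T}=\bigcup_{t\in(0,T)}\Omega_\varepsilon(t)\times\{t\}$, $\partial_\ell Q_{\varepsilon,T}=\bigcup_{t\in(0,T)}\partial\Omega_\varepsilon(t)\times\{t\}$. The unit outward normal and scalar outward normal velocity of $\partial\Omega_\varepsilon(t)$ are $\nu_\varepsilon(x,t)=\pm\nu(\pi(x,t),t)$ and $V_\varepsilon^N(x,t)=\pm V_\Gamma^N(\pi(x,t),t)$ where $d(x,t)=\pm\varepsilon$. All functions are assumed sufficiently smooth (up to the closure of their domains). Surface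 operators. $P_\Gamma=I_3-\nu\otimes\nu$; for a function $f$ on $\Gamma(t)$ with any extension $\tilde f$ to $N(t)$, $\nabla_\Gamma f=P_\Gamma\nabla\tilde f=(\partial_1^{tan}f,\partial_2^{tan}f,\partial_3^{tan}f)$ (independent of the extension); for a vector field $G$ on $\Gamma(t)$, $\mathrm{div}_\Gamma G=\sum_i\partial_i^{tan}G_i$. For a vector field $v$ on $S_T$ with $v\cdot\nu=V_\Gamma^N$, the material derivative of a (scalar or vector) function $f$ on $S_T$ is $\partial_v^\bullet f=\partial_t\tilde f+(v\cdot\nabla)\tilde f$ on $S_T$, where $\tilde f$ is any extension of $f$ to $N_T$ (independent of the extension). Expansions. To say that $f=f^\varepsilon$ on $Q_{\varepsilon,T}$ admits the expansion $f=g(\pi,t)+d\,g^1(\pi,t)+d^2g^2(\pi,t)+\cdots$ means that $g,g^1,g^2,\dots$ are smooth functions on $S_T$ (up to its closure) independent of $\varepsilon$, and for each $k\in\mathbb{N}$ one has $f(x,t)=\sum_{j=0}^{k-1}d(x,t)^jg^j(\pi(x,t),t)+R(d(x,t)^k)$ (with $g^0=g$), where $R(d^k)$ denotes the terms of order at least $k$ in $d$. The remainder may be differentiated in $x$ and $t$: its derivatives of order $l\le k$ are $R(d^{k-l})$, in particular bounded in absolute value by $C|d(x,t)|^{k-l}$ with $C$ independent of $\varepsilon$ and $(x,t)$. *)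

(* Defs.v *)
From HB Require Import structures.
From mathcomp Require Export all_boot all_order all_algebra.
From mathcomp Require Export all_classical all_reals all_analysis.
Export Order.TTheory GRing.Theory Num.Theory.
Export numFieldNormedType.Exports.
Set Implicit Arguments.
Unset Strict Implicit.
Unset Printing Implicit Defensive.
Local Open Scope classical_set_scope.
Local Open Scope ring_scope.

Notation space R := 'rV[R]_3.
Notation spacetime R := ('rV[R]_3 * R)%type.

Section Smooth.
Context {R : realType} {V W : normedModType R}.
Implicit Types (U A : set V) (f g : V -> W).

(* In finite dimension this is the usual class C^k on the open set U. *)
Fixpoint Ck (k : nat) U f : Prop :=
  if k is k'.+1 then
    (forall z, U z -> differentiable f z) /\
    (forall w : V, Ck k' U (fun z => 'D_w f z))
  else {in U, continuous f}.

Definition Cinfty U f := forall k, Ck k U f.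

(* Smoothness on an arbitrary subset: local existence of smooth extensions.
   Applied to the closure of an open set, or of a surface, this is
   "smooth up to the closure". *)
Definition smooth_on A f := forall z, A z ->
  exists (U : set V) (g : V -> W),
    [/\ open U, U z, Cinfty U g & forall y, U y -> A y -> f y = g y].

End Smooth.

Section Euclid.
Context {R : realType}.
Implicit Types (a b x w n : space R) (G : set (space R)).

(* The library norm on 'rV[R]_3 is the sup norm, hence these two. *)
Definition dot a b : R := \sum_(i < 3) a ord0 i * b ord0 i.
Definition enorm a : R := Num.sqrt (dot a a).

Definition dist x G : R := inf [set enorm (x - y) | y in G].

Definition boundary G : set (space R) := closure G `\` interior G.

Definition grad3 (f : space R -> R) x : space R :=
  \row_i 'D_(delta_mx ord0 i) f x.

Definition smooth_surface G := forall x, G x ->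
  exists (U : set (space R)) (phi : space R -> R),
    [/\ open U, U x, Cinfty U phi,
        forall y, U y -> grad3 phi y != 0 &
        forall y, U y -> (G y <-> phi y = 0)].

Definition closed_connected_surface G :=
  [/\ smooth_surface G, compact G, connected G & G !=set0].

Definition tangent_vector G x w := exists c : R -> space R,
  [/\ c 0 = x, \forall s \near (0 : R), G (c s) & is_derive (0 : R) 1 c w].

(* By the Jordan-Brouwer theorem the complement of a closed connected surface
   has exactly two components, one of them bounded. *)
Definition inside G : set (space R) :=
  [set x | ~ G x /\ bounded_set (connected_component (~` G) x)].
Definition outside G : set (space R) :=
  [set x | ~ G x /\ ~ bounded_set (connected_component (~` G) x)].

Definition unit_outward_normal G x n :=
  [/\ enorm n = 1,
      forall w, tangent_vector G x w -> dot w n = 0 &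
      \forall s \near 0^'+, outside G (x + s *: n) /\ inside G (x - s *: n)].

End Euclid.

Section Calculus.
Context {R : realType}.
Implicit Types z : spacetime R.

(* [Some i] is the i-th space direction, [None] is the time direction. *)
Definition axis (a : option 'I_3) : spacetime R :=
  if a is Some i then (delta_mx ord0 i, 0) else (0, 1).

Definition pd {W : normedModType R} a (f : spacetime R -> W) :
  spacetime R -> W := fun z => 'D_(axis a) f z.

Definition mpd {W : normedModType R} (s : seq (option 'I_3))
  (f : spacetime R -> W) : spacetime R -> W := foldr pd f s.

Definition grad (f : spacetime R -> R) z : space R := \row_i pd (Some i) f z.

Definition div (f : spacetime R -> space R) z : R :=
  \sum_(i < 3) pd (Some i) (fun y => f y ord0 i) z.

(* The derivative d_t f + (w . nabla) f. *)
Definition transport {W : normedModType R} (w : spacetime R -> space R)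
    (f : spacetime R -> W) z : W :=
  pd None f z + \sum_(i < 3) w z ord0 i *: pd (Some i) f z.

(* P = I - n (x) n; symmetric, so it may act on row vectors from the right. *)
Definition tproj (n : space R) : 'M[R]_3 := 1%:M - n^T *m n.

(* f stands for an extension of a surface function off the surface; on the
   surface the value does not depend on the extension (see smooth_extension). *)
Definition tgrad (nu : spacetime R -> space R) (f : spacetime R -> R) z :
  space R := grad f z *m tproj (nu z).

Definition tdiv (nu f : spacetime R -> space R) z : R :=
  \sum_(i < 3) tgrad nu (fun y => f y ord0 i) z ord0 i.

End Calculus.

Section MovingSurface.
Context {R : realType}.
Variables (T : R) (Gam : R -> set (space R)).

Definition tube (A : R -> set (space R)) : set (spacetime R) :=
  [set z | 0 < z.2 < T /\ A z.2 z.1].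

(* Gam t is the image of Gam 0 under a diffeomorphism depending smoothly
   on t. *)
Definition moving_smoothly := exists Phi Psi : spacetime R -> space R,
  [/\ smooth_on [set z | 0 <= z.2 <= T /\ Gam 0 z.1] Phi,
      smooth_on [set z | 0 <= z.2 <= T /\ Gam z.2 z.1] Psi,
      forall t, 0 <= t <= T -> forall y, Gam 0 y ->
        Gam t (Phi (y, t)) /\ Psi (Phi (y, t), t) = y &
      forall t, 0 <= t <= T -> forall x, Gam t x ->
        Gam 0 (Psi (x, t)) /\ Phi (Psi (x, t), t) = x].

Definition moving_closed_surface :=
  (forall t, 0 <= t <= T -> closed_connected_surface (Gam t)) /\
  moving_smoothly.

Definition outward_normal_field (nu : spacetime R -> space R) :=
  forall t x, 0 <= t <= T -> Gam t x ->
    unit_outward_normal (Gam t) x (nu (x, t)).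

(* Normal component of the velocity of any point moving with the surface. *)
Definition normal_velocity (nu : spacetime R -> space R)
    (VN : spacetime R -> R) :=
  forall t (c : R -> space R) (w : space R), 0 < t < T ->
    (\forall s \near t, Gam s (c s)) -> is_derive t 1 c w ->
    VN (c t, t) = dot w (nu (c t, t)).

Definition S_T : set (spacetime R) := tube Gam.

Definition nbhd_surf (r t : R) : set (space R) :=
  [set x | dist x (Gam t) < r].

Definition Q_T (r : R) : set (spacetime R) := tube (nbhd_surf r).

Definition lateral_boundary (r : R) : set (spacetime R) :=
  tube (fun t => boundary (nbhd_surf r t)).

(* proj and d are the closest point map and the signed distance; the equation
   x = proj + d nu(proj) fixes the sign of d so that d increases along nu. *)
Definition tubular_coordinates (nu : spacetime R -> space R) (delta : R)
    (proj : spacetime R -> space R) (d : spacetime R -> R) :=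
  [/\ forall t x, 0 <= t <= T -> nbhd_surf delta t x ->
        [/\ Gam t (proj (x, t)),
            enorm (x - proj (x, t)) = dist x (Gam t),
            `|d (x, t)| = dist x (Gam t),
            x = proj (x, t) + d (x, t) *: nu (proj (x, t), t) &
            forall y s, Gam t y -> `|s| < delta -> x = y + s *: nu (y, t) ->
              y = proj (x, t) /\ s = d (x, t)],
      smooth_on (closure (Q_T delta)) proj &
      smooth_on (closure (Q_T delta)) d].

(* f is a family indexed by the half-thickness eps.  The remainder of order k
   is R(d^k): its derivatives of every order l <= k in (x, t) are
   O(|d|^(k-l)), uniformly in eps and (x, t). *)
Definition expansion {W : normedModType R} (eps0 : R)
    (proj : spacetime R -> space R) (d : spacetime R -> R)
    (f : R -> spacetime R -> W) (g : nat -> spacetime R -> W) :=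
  (forall j, smooth_on (closure S_T) (g j)) /\
  forall k : nat, exists C : R, forall eps, 0 < eps < eps0 ->
    forall z, Q_T eps z ->
    forall s : seq (option 'I_3), (size s <= k)%N ->
      `|mpd s (fun y => f eps y -
                 \sum_(j < k) d y ^+ j *: g j (proj y, y.2)) z|
        <= C * `|d z| ^+ (k - size s).

Definition smooth_extension {W : normedModType R} (delta : R)
    (f F : spacetime R -> W) :=
  Cinfty (Q_T delta) F /\ forall z, S_T z -> F z = f z.

(* sg (d z) is +1 or -1 according to d z = eps or d z = - eps. *)
Definition nu_bd (nu proj : spacetime R -> space R) (d : spacetime R -> R) z :
  space R := Num.sg (d z) *: nu (proj z, z.2).

Definition VN_bd (VN : spacetime R -> R) (proj : spacetime R -> space R)
    (d : spacetime R -> R) z : R := Num.sg (d z) * VN (proj z, z.2).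

End MovingSurface.

Section Euler.
Context {R : realType}.

Definition euler_solution (T : R) (Gam : R -> set (space R))
    (nu : spacetime R -> space R) (VN : spacetime R -> R)
    (proj : spacetime R -> space R) (d : spacetime R -> R) (eps : R)
    (u : spacetime R -> space R) (p : spacetime R -> R) :=
  [/\ forall z, Q_T T Gam eps z -> transport u u z + grad p z = 0,
      forall z, Q_T T Gam eps z -> div u z = 0 &
      forall z, lateral_boundary T Gam eps z ->
        dot (u z) (nu_bd nu proj d z) = VN_bd VN proj d z].

End Euler.

(* Main.v *)
From HB Require Import structures.
Require Import Defs.
Set Implicit Arguments.
Unset Strict Implicit.
Unset Printing Implicit Defensive.
Local Open Scope classical_set_scope.
Local Open Scope ring_scope.

(** Everything is evaluated at a point [z] of the surface, where [d] vanishes.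
    Since [|x - proj|^2 = d^2], the derivative of [proj] fixes every direction
    in the kernel of the derivative of [d]; along the normal ray [proj] is
    constant and [d] has slope one. Testing against the curves traced by [proj]
    on the surface then gives [d' (w, s) = w . nu - s VN] and
    [proj' (w, s) = w - d' (w, s) nu].

    The second order remainder of an expansion has vanishing first derivatives
    at [z], so [u' a = vt' (proj' a, a.2) + d' a v1] for any extension [vt] of
    [v0]. The boundary condition at [x + eps nu] reads
    [v0 . nu - VN + eps (v1 . nu) = O(eps^2)], whence [v0 . nu = VN] and
    [v1 . nu = 0]. The first identity makes [d'] vanish in the transport
    direction [(v0, 1)], the second removes [v1] from the divergence. *)

(** * Differentiability, smoothness on arbitrary sets, and derivatives along lines *)

Lemma near_eq_differentiable (R : numFieldType) (V W : normedModType R)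
    (f g : V -> W) (x : V) :
  (\forall y \near x, f y = g y) -> differentiable g x -> differentiable f x.
Proof.
move=> fg dg.
have fgx : f x = g x by exact: nbhs_singleton fg.
have cdg := diff_continuous dg.
have fo : f \o shift x = cst (f x) + 'd g x +o_ 0 id.
  apply/eqaddoP => e e0.
  have /eqaddoP/(_ e e0) ge := diff_locally dg.
  have fg0 : \forall y \near (0 : V), f (y + x) = g (y + x).
    by move: fg; rewrite (near_shift 0) /= subr0.
  apply: filterS2 ge fg0 => y; rewrite !fctE /= fgx => gey fgy.
  by rewrite fgy.
have df := diff_unique cdg fo.
by apply/diff_locallyP; rewrite df.
Qed.

Lemma Cinfty_differentiable (R : realType) (V W : normedModType R)
    (U : set V) (f : V -> W) x : Cinfty U f -> U x -> differentiable f x.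
Proof. by move=> /(_ 1%N)[df _]; exact: df. Qed.

(** [smooth_on] only provides a local extension agreeing with [f] on [A], so continuity is available
    along filters that stay in [A]. *)
Lemma smooth_on_cvg (R : realType) (V W : normedModType R) (A : set V)
    (f : V -> W) (T : Type) (F : set_system T) {FF : Filter F} (c : T -> V) x :
  smooth_on A f -> A x -> c @ F --> x -> (\forall s \near F, A (c s)) ->
  f \o c @ F --> f x.
Proof.
move=> sf Ax cx Ac; have [U [g [oU Ux /(_ 0%N) /= cg fg]]] := sf _ Ax.
rewrite fg //; apply: (cvg_trans _ (cvg_comp _ _ cx (cg x _))).
2: by rewrite inE.
apply: near_eq_cvg; near=> s => /=; rewrite fg //; last exact: (near Ac s).
by near: s; apply: cx; exact: open_nbhs_nbhs.
Unshelve. all: by end_near. Qed.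

(** The local smooth extension replaces [f] along [c], so [A] may have empty interior; this is what
    makes a surface coefficient composed with the closest point map differentiable. *)
Lemma smooth_on_comp_differentiable (R : realType) (X V W : normedModType R)
    (A : set V) (f : V -> W) (c : X -> V) x :
  smooth_on A f -> differentiable c x -> (\forall y \near x, A (c y)) ->
  differentiable (f \o c) x.
Proof.
move=> sf dc Ac; have [U [g [oU Ux sg fg]]] := sf _ (nbhs_singleton Ac).
apply: (@near_eq_differentiable _ _ _ _ (g \o c)).
  near=> y => /=; apply: fg; last exact: (near Ac y).
  near: y; apply: (differentiable_continuous dc); exact: open_nbhs_nbhs.
by apply: differentiable_comp => //; exact: Cinfty_differentiable Ux.
Unshelve. all: by end_near. Qed.

Lemma smooth_on_differentiable (R : realType) (V W : normedModType R)
    (A : set V) (f : V -> W) x :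
  smooth_on A f -> (\forall y \near x, A y) -> differentiable f x.
Proof.
by move=> sf Ax; exact: (@smooth_on_comp_differentiable _ _ _ _ A f id).
Qed.

Lemma cvg_line (R : numFieldType) (V : normedModType R) (x a : V) (t : R) :
  (s - t) *: a + x @[s --> t] --> x.
Proof.
have : {for t, continuous (fun s : R => (s - t) *: a + x)}.
  apply: continuousD; last exact: cst_continuous.
  apply: (@continuous_comp _ _ _ (fun s : R => s - t) ( *:%R^~ a)).
    by apply: continuousB; [exact: cvg_id | exact: cst_continuous].
  exact: scalel_continuous.
by rewrite /prop_for /continuous_at subrr scale0r add0r.
Qed.

Lemma cvg_line_dnbhs (R : numFieldType) (V : normedModType R) (x a : V) :
  h *: a + x @[h --> (0 : R)^'] --> x.
Proof.
apply: cvg_within_filter; have := @cvg_line _ _ x a 0.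
by under eq_fun do rewrite subr0.
Qed.

Lemma diff_cvg (R : numFieldType) (V W : normedModType R) (f : V -> W) x a :
  differentiable f x ->
  h^-1 *: (f (h *: a + x) - f x) @[h --> 0^'] --> 'd f x a.
Proof. by move=> df; rewrite -deriveE //; exact: diff_derivable. Qed.

(** The shift by [t] lets the line pass through [x] at a prescribed time, the form that
    [normal_velocity] asks of curves. *)
Lemma is_derive_line (R : numFieldType) (V W : normedModType R) (f : V -> W)
    x a (t : R) : differentiable f x ->
  is_derive t 1 (fun s => f ((s - t) *: a + x)) ('d f x a).
Proof.
move=> df; have H := diff_cvg (a := a) df.
have E : (fun h => h^-1 *: (f (h *: a + x) - f x)) =
    (fun h : R => h^-1 *: (((fun s => f ((s - t) *: a + x)) \o shift t) (h *: 1)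
      - f ((t - t) *: a + x))).
  apply/funext => h /=.
  by rewrite addrK [_%:A]mulr1 subrr scale0r add0r.
rewrite E in H.
by apply: DeriveDef; [apply/cvg_ex; eexists; exact: H | exact: cvg_lim H].
Qed.

(** Since [k] vanishes at [x], the difference quotient is that of [k] times a value of [f] near [x],
    so continuity of [f] is enough. *)
Lemma is_derive_scale_root (R : numFieldType) (V W : normedModType R)
    (k : V -> R) (f : V -> W) x a :
  k x = 0 -> differentiable k x -> {for x, continuous f} ->
  is_derive x a (fun y => k y *: f y) ('d k x a *: f x).
Proof.
move=> kx0 dk cf.
have dk' := diff_cvg (a := a) dk.
have cf' : f (h *: a + x) @[h --> (0 : R)^'] --> f x.
  by apply: cvg_comp; [exact: cvg_line_dnbhs | exact: cf].
have H : (h^-1 *: (k (h *: a + x) *: f (h *: a + x) - k x *: f x)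
    @[h --> 0^'] --> 'd k x a *: f x).
  apply: (cvg_trans _ (cvgZ dk' cf')); apply: near_eq_cvg; near=> h.
  by rewrite /= kx0 scale0r !subr0 scalerA.
by apply: DeriveDef; [apply/cvg_ex; eexists; exact: H | exact: cvg_lim H].
Unshelve. all: by end_near. Qed.

(** * Euclidean inner product and distance *)

Section Euclid.
Context {R : realType}.
Implicit Types a b c : space R.

Lemma dotC a b : dot a b = dot b a.
Proof. by apply: eq_bigr => i _; rewrite mulrC. Qed.

Lemma dotBl a b c : dot (a - b) c = dot a c - dot b c.
Proof.
by rewrite /dot -sumrB; apply: eq_bigr => i _; rewrite !mxE mulrBl.
Qed.

Lemma dotDl a b c : dot (a + b) c = dot a c + dot b c.
Proof.
by rewrite /dot -big_split /=; apply: eq_bigr => i _; rewrite !mxE mulrDl.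
Qed.

Lemma dotZl (k : R) a b : dot (k *: a) b = k * dot a b.
Proof.
by rewrite /dot mulr_sumr; apply: eq_bigr => i _; rewrite !mxE mulrA.
Qed.

Lemma dot_ge0 a : 0 <= dot a a.
Proof. by apply: sumr_ge0 => i _; rewrite -expr2 sqr_ge0. Qed.

Lemma dot_eq0 a : dot a a = 0 -> a = 0.
Proof.
move=> /eqP; rewrite psumr_eq0 => [/allP a0|i _].
2: by rewrite -expr2 sqr_ge0.
apply/rowP => i; rewrite mxE; apply/eqP.
by have := a0 i (mem_index_enum _); rewrite mulf_eq0 orbb.
Qed.

Lemma dist_le a b (G : set (space R)) : G b -> dist a G <= enorm (a - b).
Proof.
move=> Gb; apply: ge_inf; last by exists b.
by exists 0 => _ [z _ <-]; exact: sqrtr_ge0.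
Qed.

Lemma cvg_dot (T : Type) (F : set_system T) {FF : Filter F}
    (f g : T -> space R) a b :
  f @ F --> a -> g @ F --> b -> dot (f s) (g s) @[s --> F] --> dot a b.
Proof.
move=> fa gb; rewrite /dot.
have cm (h : T -> space R) (e : space R) : h @ F --> e -> forall i,
    h s ord0 i @[s --> F] --> e ord0 i.
  move=> he i; apply: (@cvg_comp _ _ _ h (fun M : space R => M ord0 i)).
    exact: he.
  exact: coord_continuous.
apply: cvg_big => [|i _]; first exact: add_continuous.
by apply: cvgM; exact: cm.
Qed.

(** The norm of [a] here is the sup norm, whose dual is the sum of absolute values. *)
Lemma dot_norm_le a b : `|dot a b| <= `|a| * \sum_(i < 3) `|b ord0 i|.
Proof.
rewrite /dot mulr_sumr (le_trans (ler_norm_sum _ _ _))//.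
apply: ler_sum => i _; rewrite normrM ler_wpM2r//.
by rewrite [leRHS]/Num.Def.normr/= mx_normrE; exact: le_bigmax (ord0, i).
Qed.

End Euclid.

(** * Differential operators expressed through the space-time differential *)

Section Calculus.
Context {R : realType}.
Implicit Types a z : spacetime R.

Lemma spacetime_axis a :
  a = a.2 *: axis None + \sum_(i < 3) a.1 ord0 i *: axis (Some i).
Proof.
case: a => x t; congr pair => /=.
  rewrite scaler0 add0r [LHS]matrix_sum_delta big_ord1.
  rewrite (big_morph fst (id1 := 0) (op1 := +%R)) //.
rewrite (big_morph snd (id1 := 0) (op1 := +%R)) // big1 => [|i _] /=.
  by rewrite addr0 [_%:A]mulr1.
by rewrite scaler0.
Qed.

(** Expansions bound derivatives only along the axes; this carries the resulting identities to all
    directions. *)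
Lemma linear_eq_axis (W : lmodType R) (f g : {linear spacetime R -> W}) :
  (forall i, f (axis i) = g (axis i)) -> f =1 g.
Proof.
move=> fg a; rewrite (spacetime_axis a) !linearD !linearZ fg !linear_sum.
by congr (_ + _); apply: eq_bigr => i _; rewrite !linearZ fg.
Qed.

Lemma transport_diff (W : normedModType R) (w : spacetime R -> space R)
    (f : spacetime R -> W) z :
  differentiable f z -> transport w f z = 'd f z (w z, 1).
Proof.
move=> df; rewrite (spacetime_axis (w z, 1)) linearD scale1r linear_sum /=.
rewrite /transport /pd deriveE //; congr (_ + _).
by apply: eq_bigr => i _; rewrite linearZ deriveE.
Qed.

Lemma grad_diff (f : spacetime R -> R) z (i : 'I_3) :
  differentiable f z -> grad f z ord0 i = 'd f z (delta_mx ord0 i, 0).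
Proof. by move=> df; rewrite mxE /pd deriveE. Qed.

Lemma derive_coord (f : spacetime R -> space R) z a (i : 'I_3) :
  differentiable f z -> 'D_a (fun y => f y ord0 i) z = 'd f z a ord0 i.
Proof.
move=> df; rewrite -deriveE // derive_mx; last exact: diff_derivable.
by rewrite mxE.
Qed.

Lemma differentiable_coord_comp (f : spacetime R -> space R) z (i : 'I_3) :
  differentiable f z -> differentiable (fun y => f y ord0 i) z.
Proof.
move=> df.
apply: (@differentiable_comp _ _ _ _ f (fun N : 'M[R]_(1, 3) => N ord0 i : R)).
  exact: df.
exact: differentiable_coord.
Qed.

Lemma div_diff (f : spacetime R -> space R) z : differentiable f z ->
  div f z = \sum_(i < 3) 'd f z (delta_mx ord0 i, 0) ord0 i.
Proof. by move=> df; apply: eq_bigr => i _; rewrite /pd derive_coord. Qed.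

Lemma tproj_mul (n x : space R) : x *m tproj n = x - dot x n *: n.
Proof.
rewrite /tproj mulmxBr mulmx1 mulmxA; congr (_ - _).
apply/rowP => i; rewrite !mxE big_ord1 !mxE; congr (_ * _).
by apply: eq_bigr => j _; rewrite mxE.
Qed.

(** The projection is symmetric, so a component of the projected gradient is the derivative along
    the projected basis vector. *)
Lemma tgrad_diff (nu : spacetime R -> space R) (f : spacetime R -> R) z
    (i : 'I_3) : differentiable f z ->
  tgrad nu f z ord0 i = 'd f z (delta_mx ord0 i - nu z ord0 i *: nu z, 0).
Proof.
move=> df; rewrite /tgrad tproj_mul.
have -> : (delta_mx ord0 i - nu z ord0 i *: nu z, 0) =
    (delta_mx ord0 i, 0) - nu z ord0 i *: (nu z, 0) :> spacetime R.
  by congr pair => /=; rewrite scaler0 subr0.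
rewrite linearB [in RHS]linearZ -grad_diff // mxE [X in _ + X]mxE.
congr (_ - _); rewrite mxE mulrC; congr (_ * _).
rewrite [in RHS](spacetime_axis (nu z, 0)) scale0r add0r linear_sum.
apply: eq_bigr => j _; rewrite linearZ grad_diff //; exact: mulrC.
Qed.

Lemma tdiv_diff (nu f : spacetime R -> space R) z : differentiable f z ->
  tdiv nu f z =
  \sum_(i < 3) 'd f z (delta_mx ord0 i - nu z ord0 i *: nu z, 0) ord0 i.
Proof.
move=> df; apply: eq_bigr => i _.
rewrite tgrad_diff; last exact: differentiable_coord_comp.
by rewrite -deriveE ?derive_coord //; exact: differentiable_coord_comp.
Qed.

End Calculus.

Lemma enormZ (R : realType) (s : R) (a : space R) :
  enorm (s *: a) = `|s| * enorm a.
Proof.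
rewrite /enorm dotZl dotC dotZl mulrA -expr2 sqrtrM ?sqr_ge0 //.
by rewrite sqrtr_sqr.
Qed.

(** * Derivatives of the closest point map and the signed distance on the surface *)

Section MovingSurface.
Context {R : realType} {T : R} {Gam : R -> set (space R)}.
Implicit Types z a : spacetime R.

(** The point of [Gam 0] that sits at [x] at time [t] is carried continuously by [Phi]; its position
    at a nearby time lies on the surface of that time and close to every point near [x]. *)
Lemma near_Q_T r z : moving_closed_surface T Gam -> 0 < r -> S_T T Gam z ->
  \forall y \near z, Q_T T Gam r y.
Proof.
case: z => x t [_ [Phi [Psi [sPhi _ PhiP PsiP]]]] r0 [/= /andP[t0 tT] Gx].
have t0T : 0 <= t <= T by rewrite !ltW.
have [G0 Phi0] := PsiP _ t0T _ Gx.
set y0 := Psi (x, t) in G0 Phi0.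
have time : \forall y \near (x, t), 0 < y.2 < T.
  have c2 : y.2 @[y --> (x, t)] --> t by exact: cvg_snd.
  near=> y; apply/andP; split; near: y; first exact: cvgr_gt c2 _ t0.
  exact: cvgr_lt c2 _ tT.
have cPhi : Phi (y0, y.2) @[y --> (x, t)] --> x.
  have cy : (fun y : spacetime R => (y0, y.2)) @ (x, t) --> (y0, t).
    exact: (@cvg_pair _ _ _ (nbhs (x, t)) (nbhs y0) (nbhs t) _ _ _ (cst y0) snd
      (cvg_cst y0) cvg_snd).
  have := smooth_on_cvg sPhi _ cy; rewrite Phi0; apply; first by split.
  by apply: filterS time => y /andP[? ?]; split => //=; rewrite !ltW.
have cdiff : y.1 - Phi (y0, y.2) @[y --> (x, t)] --> x - x.
  by apply: cvgB => //; exact: cvg_fst.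
have := cvg_dot cdiff cdiff; rewrite subrr.
have -> : dot 0 0 = 0 :> R by rewrite /dot big1 // => i _; rewrite mxE mul0r.
move=> c0; have r2 : 0 < r ^+ 2 by rewrite exprn_gt0.
near=> y; have yT : 0 < y.2 < T by near: y.
split => //.
have [Gy _] : Gam y.2 (Phi (y0, y.2)) /\ Psi (Phi (y0, y.2), y.2) = y0.
  by apply: PhiP => //; case/andP: yT => *; rewrite !ltW.
apply: le_lt_trans (dist_le _ Gy) _.
rewrite -(gtr0_norm r0) -sqrtr_sqr ltr_sqrt //.
by near: y; exact: (cvgr_lt _ (c0 _)) _ r2.
Unshelve. all: by end_near. Qed.

Context {nu : spacetime R -> space R} {VN : spacetime R -> R} {delta : R}.
Context {proj : spacetime R -> space R} {d : spacetime R -> R}.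
Hypothesis movG : moving_closed_surface T Gam.
Hypothesis nuG : outward_normal_field T Gam nu.
Hypothesis VNG : normal_velocity T Gam nu VN.
Hypothesis delta0 : 0 < delta.
Hypothesis tubG : tubular_coordinates T Gam nu delta proj d.

Lemma normal_enorm z : S_T T Gam z -> enorm (nu z) = 1.
Proof.
case: z => x t [/andP[/ltW t0 /ltW tT] Gx].
by have [] := @nuG t x _ Gx; rewrite ?t0.
Qed.

Lemma normal_dot z : S_T T Gam z -> dot (nu z) (nu z) = 1.
Proof.
move=> /normal_enorm n1.
by rewrite -[LHS]sqr_sqrtr ?dot_ge0// -/(enorm _) n1 expr1n.
Qed.

(** The point is given in the form of a tubular decomposition, and such decompositions are
    unique. *)
Lemma tube_ray s z : S_T T Gam z -> `|s| < delta ->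
  [/\ dist (z.1 + s *: nu z) (Gam z.2) = `|s|,
      proj (z.1 + s *: nu z, z.2) = z.1 & d (z.1 + s *: nu z, z.2) = s].
Proof.
move=> Sz; have n1 := normal_enorm Sz; case: z Sz n1 => x t [tT Gx] n1 sd /=.
have t0T : 0 <= t <= T by case/andP: tT => *; rewrite !ltW.
have [tub _ _] := tubG.
have xd : nbhd_surf Gam delta t (x + s *: nu (x, t)).
  apply: le_lt_trans (dist_le _ Gx) _.
  by rewrite addrAC subrr add0r enormZ n1 mulr1.
have [_ _ dE _ uniq] := tub _ _ t0T xd.
by have [<- sE] := uniq x s Gx sd erefl; rewrite -dE -sE.
Qed.

Lemma tube_surf z : S_T T Gam z -> proj z = z.1 /\ d z = 0.
Proof.
move=> Sz; have := @tube_ray 0 _ Sz; rewrite normr0 scale0r addr0.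
by case: z Sz => x t Sz /(_ delta0)[].
Qed.

Lemma closure_Q_T z : S_T T Gam z ->
  \forall y \near z, closure (Q_T T Gam delta) y.
Proof.
move=> Sz; apply: filterS (near_Q_T movG delta0 Sz) => y.
exact: subset_closure.
Qed.

Lemma differentiable_proj z : S_T T Gam z -> differentiable proj z.
Proof.
move=> Sz; have [_ sp _] := tubG.
exact: smooth_on_differentiable (closure_Q_T Sz).
Qed.

Lemma differentiable_dist z : S_T T Gam z -> differentiable d z.
Proof.
move=> Sz; have [_ _ sd] := tubG.
exact: smooth_on_differentiable (closure_Q_T Sz).
Qed.

Lemma Q_T_tube y : Q_T T Gam delta y ->
  Gam y.2 (proj y) /\ dot (y.1 - proj y) (y.1 - proj y) = d y ^+ 2.
Proof.
case: y => x t [/andP[/ltW t0 /ltW tT] xd]; have [tub _ _] := tubG.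
have [|Gp e1 e2 _ _] := tub t x _ xd; first by rewrite t0.
split=> //=; rewrite -[LHS]sqr_sqrtr ?dot_ge0// -/(enorm _) e1 -e2.
by rewrite real_normK ?num_real.
Qed.

(** Both [x - proj] and [d] vanish at [z], so dividing [|x - proj|^2 = d^2] by [h^2] along a line
    leaves squared difference quotients, which converge. *)
Lemma dot_diff_proj z a : S_T T Gam z ->
  dot (a.1 - 'd proj z a) (a.1 - 'd proj z a) = ('d d z a) ^+ 2.
Proof.
move=> Sz; have [pz dz] := tube_surf Sz.
have cp := diff_cvg (a := a) (differentiable_proj Sz).
have cd := diff_cvg (a := a) (differentiable_dist Sz).
have cr : a.1 - h^-1 *: (proj (h *: a + z) - proj z) @[h --> (0 : R)^']
    --> a.1 - 'd proj z a.
  by apply: cvgB => //; exact: cvg_cst.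
rewrite expr2; apply: (cvg_unique _ (cvg_dot cr cr)).
  exact: norm_hausdorff.
apply: cvg_trans (cvgM cd cd); apply: near_eq_cvg.
have nQ : \forall h \near (0 : R)^', Q_T T Gam delta (h *: a + z).
  exact: (@cvg_line_dnbhs _ _ z a _ (near_Q_T movG delta0 Sz)).
near=> h; have h0 : h != 0 by near: h; exact: nbhs_dnbhs_neq.
have /Q_T_tube[_] : Q_T T Gam delta (h *: a + z) by near: h.
move=> E; rewrite [LHS]/= dz subr0 pz.
have -> : a.1 - h^-1 *: (proj (h *: a + z) - z.1) =
    h^-1 *: ((h *: a + z).1 - proj (h *: a + z)).
  rewrite -(scalerK h0 a.1) -scalerBr; congr (_ *: _).
  by rewrite opprB addrA.
by rewrite dotZl dotC dotZl E expr2 mulrA mulrACA -mulrA.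
Unshelve. all: by end_near. Qed.

Lemma diff_near_eq (W : normedModType R) (f : spacetime R -> W) z a l :
  differentiable f z ->
  (\forall h \near (0 : R), f (h *: a + z) - f z = h *: l) ->
  'd f z a = l.
Proof.
move=> df E; have H := diff_cvg (a := a) df.
have H' : h^-1 *: (f (h *: a + z) - f z) @[h --> (0 : R)^'] --> l.
  apply: cvg_near_cst; near=> h.
  have h0 : h != 0 by near: h; exact: nbhs_dnbhs_neq.
  have -> : f (h *: a + z) - f z = h *: l by near: h; exact: nbhs_dnbhs E.
  by rewrite scalerK.
exact: (cvg_unique (@norm_hausdorff _ _) H H').
Unshelve. all: by end_near. Qed.

Lemma near_ray z : S_T T Gam z -> \forall h \near (0 : R),
  proj (h *: (nu z, 0) + z) = z.1 /\ d (h *: (nu z, 0) + z) = h.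
Proof.
move=> Sz; near=> h.
have hd : `|h| < delta by near: h; exact: (@nbhs0_lt _ R).
have [_ ph dh] := tube_ray Sz hd.
suff -> : h *: (nu z, 0) + z = (z.1 + h *: nu z, z.2) by [].
by congr pair => /=; rewrite ?scaler0 ?add0r // addrC.
Unshelve. all: by end_near. Qed.

Lemma diff_proj_ray z : S_T T Gam z -> 'd proj z (nu z, 0) = 0.
Proof.
move=> Sz; apply: diff_near_eq; first exact: differentiable_proj.
apply: filterS (near_ray Sz) => h [-> _].
by rewrite (tube_surf Sz).1 subrr scaler0.
Qed.

Lemma diff_dist_ray z : S_T T Gam z -> 'd d z (nu z, 0) = 1.
Proof.
move=> Sz; apply: diff_near_eq; first exact: differentiable_dist.
apply: filterS (near_ray Sz) => h [_ ->].
by rewrite (tube_surf Sz).2 subr0 [_%:A]mulr1.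
Qed.

(* Subtracting a multiple of the normal ray makes the derivative of [d] vanish,
   and then [dot_diff_proj] forces [proj] to move like the point itself. *)
Lemma diff_proj_dist z a : S_T T Gam z ->
  'd proj z a = a.1 - 'd d z a *: nu z.
Proof.
move=> Sz; pose b := a - 'd d z a *: ((nu z, 0) : spacetime R).
have db : 'd d z b = 0.
  by rewrite linearB linearZ /= diff_dist_ray // [_%:A]mulr1 subrr.
have pb : 'd proj z b = 'd proj z a.
  by rewrite linearB linearZ /= diff_proj_ray // scaler0 subr0.
have := dot_diff_proj b Sz; rewrite db expr0n /= => /dot_eq0/eqP.
by rewrite subr_eq0 pb => /eqP <-.
Qed.

Lemma near_surf_line z a : S_T T Gam z -> forall t : R,
  \forall s \near t, Gam ((s - t) *: a + z).2 (proj ((s - t) *: a + z)).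
Proof.
move=> Sz t.
have H : \forall s \near t, Q_T T Gam delta ((s - t) *: a + z).
  exact: (@cvg_line _ _ z a t _ (near_Q_T movG delta0 Sz)).
by apply: filterS H => s /Q_T_tube[].
Qed.

(** Projecting the line in direction [w] gives a curve on the surface at a fixed time; its velocity
    [w - 'd d z (w, 0) *: nu z] is tangent, hence orthogonal to [nu z]. *)
Lemma diff_dist_space z w : S_T T Gam z -> 'd d z (w, 0) = dot w (nu z).
Proof.
move=> Sz; have [_ tang _] : unit_outward_normal (Gam z.2) z.1 (nu z).
  case: z Sz => x t [/andP[/ltW t0 /ltW tT] Gx].
  by apply: nuG => //; rewrite t0.
have /tang : tangent_vector (Gam z.2) z.1 ('d proj z (w, 0)).
  exists (fun s => proj ((s - 0) *: (w, 0) + z)); split.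
  - by rewrite subrr scale0r add0r (tube_surf Sz).1.
  - have := near_surf_line (w, 0) Sz 0; apply: filterS => s.
    by rewrite /= scaler0 add0r.
  - exact/is_derive_line/differentiable_proj.
rewrite diff_proj_dist //= dotBl dotZl normal_dot // mulr1.
by move/subr0_eq.
Qed.

(** The closest points to a point fixed in space form a curve moving with the surface; its velocity
    is [- 'd d z (0, 1) *: nu z], and [VN z] is the normal component. *)
Lemma diff_dist_time z : S_T T Gam z -> 'd d z (0, 1) = - VN z.
Proof.
move=> Sz; have [pz _] := tube_surf Sz.
pose c s := proj ((s - z.2) *: (0, 1) + z).
have ct : c z.2 = z.1 by rewrite /c subrr scale0r add0r.
have zT : 0 < z.2 < T by case: Sz.
have Gc : \forall s \near z.2, Gam s (c s).
  have := near_surf_line (0, 1) Sz z.2; apply: filterS => s.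
  by rewrite /= [_%:A]mulr1 subrK.
have dc : is_derive z.2 1 c ('d proj z (0, 1)).
  exact/is_derive_line/differentiable_proj.
have := VNG zT Gc dc; rewrite ct -surjective_pairing => ->.
by rewrite diff_proj_dist //= sub0r -scaleNr dotZl normal_dot // mulr1 opprK.
Qed.

Lemma diff_dist z a : S_T T Gam z ->
  'd d z a = dot a.1 (nu z) - a.2 * VN z.
Proof.
move=> Sz; have -> : a = (a.1, 0) + a.2 *: (0, 1).
  case: a => w t; congr pair => /=; first by rewrite scaler0 addr0.
  by rewrite add0r [_%:A]mulr1.
rewrite linearD linearZ /= diff_dist_space // diff_dist_time //=.
by rewrite scaler0 addr0 add0r [_%:A]mulr1 -mulrN.
Qed.

End MovingSurface.

(** * Limits at closure points and estimates for a small parameter *)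

Lemma closure_cvg (X : topologicalType) (A : set X) (I : Type)
    (F : set_system I) {FF : ProperFilter F} (c : I -> X) x :
  c @ F --> x -> (\forall s \near F, A (c s)) -> closure A x.
Proof.
move=> cx Ac B nB; have nBc : \forall s \near F, B (c s) by exact: cx.
by have [s [As Bs]] := filter_ex (filterI Ac nBc); exists (c s).
Qed.

Lemma eq0_le_linear (R : realType) (a K e0 : R) : 0 < e0 ->
  (forall e, 0 < e < e0 -> `|a| <= K * e) -> a = 0.
Proof.
move=> e00 aK; apply/normr0_eq0/le_anti; rewrite normr_ge0 andbT.
have K0 : K * e @[e --> 0^'+] --> K * 0.
  by apply: cvgM; [exact: cvg_cst | exact: cvg_at_right_filter].
rewrite mulr0 in K0; apply: (ler_cvg_to (cvg_cst `|a|) K0).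
near=> e; apply: aK; apply/andP; split; near: e; first exact: nbhs_right_gt.
exact: nbhs_right_lt.
Unshelve. all: by end_near. Qed.

Lemma eq0_le_quadratic (R : realType) (a b K e0 : R) : 0 < e0 ->
  (forall e, 0 < e < e0 -> `|a + e * b| <= K * e ^+ 2) -> a = 0 /\ b = 0.
Proof.
move=> e00 abK.
have a0 : a = 0.
  (* From [|a| <= |a + e b| + e |b|], with one factor of [e^2] bounded by [e0]. *)
  apply: (eq0_le_linear (K := `|b| + `|K| * e0) e00) => e ee.
  have /andP[e0' ee0] := ee.
  rewrite -[X in `|X|](addrK (e * b) a) (le_trans (ler_normB _ _))//.
  rewrite mulrDl [leRHS]addrC lerD //.
  2: by rewrite normrM (gtr0_norm e0') mulrC.
  rewrite (le_trans (abK _ ee)) // expr2 mulrA ler_wpM2r ?(ltW e0')//.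
  by rewrite (le_trans (ler_norm _)) // normrM (gtr0_norm e0') ler_wpM2l // ltW.
split=> //; apply: (eq0_le_linear (K := K) e00) => e ee.
have /andP[e0' ee0] := ee.
have := abK _ ee; rewrite a0 add0r normrM (gtr0_norm e0') expr2 mulrA mulrC.
by rewrite ler_pM2r.
Qed.

(** * Consequences of the expansions on the surface and at the lateral boundary *)

Section Expansion.
Context {R : realType} {T : R} {Gam : R -> set (space R)}.
Context {nu : spacetime R -> space R} {VN : spacetime R -> R} {delta : R}.
Context {proj : spacetime R -> space R} {d : spacetime R -> R} {eps0 : R}.
Hypothesis movG : moving_closed_surface T Gam.
Hypothesis nuG : outward_normal_field T Gam nu.
Hypothesis delta0 : 0 < delta.
Hypothesis tubG : tubular_coordinates T Gam nu delta proj d.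
Hypothesis eps0_lt : eps0 < delta.
Implicit Types z a : spacetime R.

Section Family.
Context {W : normedModType R} {f : R -> spacetime R -> W}.
Context {g : nat -> spacetime R -> W}.
Hypothesis expf : expansion T Gam eps0 proj d f g.

(** The remainder of order one is at most [C * |d z|], and [d z = 0]. *)
Lemma expansion_value eps z : 0 < eps < eps0 -> S_T T Gam z ->
  f eps z = g 0%N z.
Proof.
move=> /[dup] eps_in /andP[e0 _] Sz; have [_ /(_ 1%N)[C fC]] := expf.
have [pz dz] := tube_surf nuG delta0 tubG Sz.
have Qz := nbhs_singleton (near_Q_T movG e0 Sz).
have := fC _ eps_in _ Qz [::] isT.
rewrite /= big_ord1 expr0 scale1r pz -surjective_pairing dz normr0 subn0 expr1.
by rewrite mulr0 normr_le0 subr_eq0 => /eqP.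
Qed.

(** Pulling back along [foot] turns coefficients meaningful only on the surface into functions near
    it. *)
Let foot (y : spacetime R) : spacetime R := (proj y, y.2).

Let foot_diff z : S_T T Gam z -> is_diff z foot (fun a => ('d proj z a, a.2)).
Proof.
move=> Sz; apply: is_diff_pair.
  exact/differentiableP/(differentiable_proj movG delta0 tubG).
have csnd : continuous (snd : spacetime R -> R) by move=> ?; exact: cvg_snd.
apply: DiffDef; first exact/linear_differentiable.
by rewrite diff_lin.
Qed.

Let near_foot z : S_T T Gam z -> \forall y \near z, S_T T Gam (foot y).
Proof.
move=> Sz; apply: filterS (near_Q_T movG delta0 Sz) => y Qy; split.
  by case: Qy.
by have [] := Q_T_tube tubG Qy.
Qed.

(* On the surface [d] vanishes, so the first derivatives of the remainder of
   order two vanish there as well. *)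
Lemma diff_expansion eps F z w t b k : 0 < eps < eps0 ->
  differentiable (f eps) z -> smooth_extension T Gam delta (g 0%N) F ->
  S_T T Gam z -> 'd proj z (w, t) = b -> 'd d z (w, t) = k ->
  'd (f eps) z (w, t) = 'd F z (b, t) + k *: g 1%N z.
Proof.
move=> eps_in df [sF FE] Sz <- <-; have /andP[e0 _] := eps_in.
have [pz dz] := tube_surf nuG delta0 tubG Sz.
have footz : foot z = z by rewrite /foot pz -surjective_pairing.
have dfoot := foot_diff Sz.
have dF : differentiable F (foot z).
  rewrite footz; apply: Cinfty_differentiable sF _.
  exact: nbhs_singleton (near_Q_T movG delta0 Sz).
have dFf : differentiable (F \o foot) z by exact: differentiable_comp.
(* Continuity suffices below, because the factor [d] vanishes at [z]. *)
have cg1 : {for z, continuous (g 1%N \o foot)}.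
  apply/differentiable_continuous.
  apply: (smooth_on_comp_differentiable (expf.1 1%N)); first by [].
  by apply: filterS (near_foot Sz) => y; exact: subset_closure.
have dd := differentiable_dist movG delta0 tubG Sz.
suff : (fun a => 'd (f eps) z a) =1
    (fun a => 'd (F \o foot) z a + 'd d z a *: g 1%N z).
  by move=> ->; rewrite diff_comp //= footz diff_val.
have lin : linear (fun a => 'd (F \o foot) z a + 'd d z a *: g 1%N z).
  move=> l x y /=; rewrite !linearPZ /= scalerDl scalerDr -scalerA.
  by rewrite addrACA.
pose L : {linear spacetime R -> W} :=
  HB.pack (fun a => 'd (F \o foot) z a + 'd d z a *: g 1%N z)
    (GRing.isLinear.Build _ _ _ _ _ lin).
apply: (@linear_eq_axis _ _ ('d (f eps) z) L) => i /=.
have [_ /(_ 2%N)[C fC]] := expf.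
have Qz := nbhs_singleton (near_Q_T movG e0 Sz).
have := fC _ eps_in _ Qz [:: i] isT.
rewrite dz normr0 expr1 mulr0 normr_le0 /= /pd => /eqP.
rewrite (@near_eq_derive _ _ _ _
  (f eps - ((F \o foot) + (fun y => d y *: (g 1%N \o foot) y)))).
  have d1 := is_derive_scale_root (axis i) dz dd cg1.
  have d2 := derivableP (diff_derivable (v := axis i) dFf).
  have d3 := derivableP (diff_derivable (v := axis i) df).
  rewrite (@derive_val _ _ _ _ _ _ _ (is_deriveB d3 (is_deriveD d2 d1))).
  by rewrite !deriveE // /comp footz => /subr0_eq.
(* Near [z] the feet lie on the surface, where [F] agrees with [g 0]. *)
apply: filterS (near_foot Sz) => y Sy.
by rewrite !fctE /= big_ord_recl big_ord1 expr0 expr1 scale1r FE.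
Qed.

End Family.

(* The boundary condition is read off at [z.1 + eps *: nu z], which [Q_T eps]
   only contains in its closure; the expansion reaches it along the normal. *)
Lemma boundary_expansion (u : R -> spacetime R -> space R) v z :
  expansion T Gam eps0 proj d u v ->
  (forall eps, 0 < eps < eps0 ->
    smooth_on (closure (Q_T T Gam eps)) (u eps) /\
    forall y, lateral_boundary T Gam eps y ->
      dot (u eps y) (nu_bd nu proj d y) = VN_bd VN proj d y) ->
  S_T T Gam z ->
  exists K, forall eps, 0 < eps < eps0 ->
    `|(dot (v 0%N z) (nu z) - VN z) + eps * dot (v 1%N z) (nu z)|
      <= K * eps ^+ 2.
Proof.
move=> [_ /(_ 2%N)[C uC]] bdu Sz.
(* [C] bounds the second order remainder of [u]; the sum comes from pairing it with the normal. *)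
exists (C * \sum_(i < 3) `|nu z ord0 i|) => eps eps_in.
have [su bd] := bdu _ eps_in; have /andP[e0 ee0] := eps_in.
pose w : spacetime R := (z.1 + eps *: nu z, z.2).
pose c s := (s - eps) *: ((nu z, 0) : spacetime R) + w.
have cE s : c s = (z.1 + s *: nu z, z.2).
  congr pair => /=; last by rewrite scaler0 add0r.
  by rewrite scalerBl addrCA subrK.
have ray s : 0 < s <= eps ->
    [/\ dist (z.1 + s *: nu z) (Gam z.2) = s, proj (c s) = z.1 & d (c s) = s].
  move=> /andP[s0 se]; have sE := gtr0_norm s0.
  have sd : `|s| < delta.
    by rewrite sE (le_lt_trans se) // (lt_trans ee0).
  have [ds ps dds] := tube_ray nuG tubG Sz sd.
  by rewrite cE -[RHS]sE.
have cw : c s @[s --> eps^'-] --> w.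
  exact/cvg_at_left_filter/cvg_line.
have near_s : \forall s \near eps^'-, 0 < s < eps.
  near=> s; apply/andP; split; near: s; last exact: nbhs_left_lt.
  exact: nbhs_left_gt.
have Qc : \forall s \near eps^'-, Q_T T Gam eps (c s).
  apply: filterS near_s => s /andP[s0 se]; have [|ds _ _] := ray s.
    by rewrite s0 ltW.
  by rewrite cE; split; [case: Sz | rewrite /nbhd_surf /= ds].
have [|dw pw ddw] := ray eps; first by rewrite e0 lexx.
have ceps : c eps = w by rewrite cE.
rewrite ceps in pw ddw.
have Qw : closure (Q_T T Gam eps) w by exact: closure_cvg cw Qc.
have cu : u eps (c s) @[s --> eps^'-] --> u eps w.
  apply: smooth_on_cvg su Qw cw _.
  by apply: filterS Qc => s; exact: subset_closure.
have uw : `|u eps w - (v 0%N z + eps *: v 1%N z)| <= C * eps ^+ 2.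
  have ce : s @[s --> eps^'-] --> eps by exact: cvg_at_left_filter.
  have l1 : `|u eps (c s) - (v 0%N z + s *: v 1%N z)| @[s --> eps^'-] -->
      `|u eps w - (v 0%N z + eps *: v 1%N z)|.
    apply: cvg_norm; apply: cvgB => //; apply: cvgD; first exact: cvg_cst.
    by apply: cvgZ => //; exact: cvg_cst.
  have l2 : C * s ^+ 2 @[s --> eps^'-] --> C * eps ^+ 2.
    by apply: cvgM; [exact: cvg_cst | rewrite expr2; exact: cvgM].
  apply: (ler_cvg_to l1 l2); apply: filterS2 Qc near_s => s Qs /andP[s0 se].
  have [|_ ps ds] := ray s; first by rewrite s0 ltW.
  have := uC _ eps_in _ Qs [::] isT.
  rewrite /= big_ord_recl big_ord1 /= expr0 expr1 scale1r ps ds subn0.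
  by rewrite scaler0 add0r -surjective_pairing (gtr0_norm s0).
(* Points of the ray at distance below [eps] accumulate at [w], whose own distance is exactly
   [eps]. *)
have lw : lateral_boundary T Gam eps w.
  split; first by case: Sz.
  split; last by move=> /interior_subset; rewrite /nbhd_surf /= dw ltxx.
  have cw1 : (s - eps) *: nu z + w.1 @[s --> eps^'-] --> w.1.
    exact/cvg_at_left_filter/cvg_line.
  apply: closure_cvg cw1 _; apply: filterS Qc => s [_].
  have -> : (s - eps) *: nu z + w.1 = (c s).1 by [].
  by rewrite cE.
have := bd _ lw; rewrite /nu_bd /VN_bd pw ddw gtr0_sg // scale1r mul1r.
rewrite -surjective_pairing => <-.
rewrite -dotZl addrAC -dotDl -dotBl (le_trans (dot_norm_le _ _)) //.
rewrite -normrN opprB mulrAC; apply: ler_wpM2r => //; exact: sumr_ge0.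
Unshelve. all: by end_near. Qed.

End Expansion.

(** * The limit equations on the surface *)

Theorem theorem3p1 (R : realType) (T : R) (Gam : R -> set (space R))
  (nu : spacetime R -> space R) (VN : spacetime R -> R)
  (delta : R) (proj : spacetime R -> space R) (d : spacetime R -> R)
  (eps0 : R) (u : R -> spacetime R -> space R) (p : R -> spacetime R -> R)
  (v : nat -> spacetime R -> space R) (q : nat -> spacetime R -> R) :
  0 < T ->
  moving_closed_surface T Gam ->
  outward_normal_field T Gam nu ->
  normal_velocity T Gam nu VN ->
  0 < delta ->
  tubular_coordinates T Gam nu delta proj d ->
  0 < eps0 < delta ->
  (forall eps, 0 < eps < eps0 ->
     [/\ smooth_on (closure (Q_T T Gam eps)) (u eps),
         smooth_on (closure (Q_T T Gam eps)) (p eps) &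
         euler_solution T Gam nu VN proj d eps (u eps) (p eps)]) ->
  expansion T Gam eps0 proj d u v ->
  expansion T Gam eps0 proj d p q ->
  (forall z, S_T T Gam z -> dot (v 0%N z) (nu z) = VN z) /\
  (forall (vt : spacetime R -> space R) (qt : spacetime R -> R),
     smooth_extension T Gam delta (v 0%N) vt ->
     smooth_extension T Gam delta (q 0%N) qt ->
     forall z, S_T T Gam z ->
       transport (v 0%N) vt z + tgrad nu qt z + q 1%N z *: nu z = 0 /\
       tdiv nu vt z = 0).
Proof.
move=> T0 movG nuG VNG delta0 tubG /andP[eps00 eps0d] sol expu expp.
have normal z : S_T T Gam z ->
    dot (v 0%N z) (nu z) = VN z /\ dot (v 1%N z) (nu z) = 0.
  move=> Sz; have bdu eps : 0 < eps < eps0 ->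
      smooth_on (closure (Q_T T Gam eps)) (u eps) /\
      forall y, lateral_boundary T Gam eps y ->
        dot (u eps y) (nu_bd nu proj d y) = VN_bd VN proj d y.
    by move=> /sol[su _ [_ _ bd]].
  have [K HK] := boundary_expansion nuG tubG eps0d expu bdu Sz.
  by have [/subr0_eq ? ?] := eq0_le_quadratic eps00 HK.
split=> [z /normal[]//|vt qt ext_v ext_q z Sz].
have [v0n v1n] := normal z Sz.
(* The coefficients do not depend on the thickness, so the equations at one admissible value suffice
   from here on. *)
pose eps := eps0 / 2.
have eps_in : 0 < eps < eps0.
  by rewrite divr_gt0 //= ltr_pdivrMr // ltr_pMr // ltr1n.
have [su sp [momentum incompressible _]] := sol _ eps_in.
have /andP[e0 _] := eps_in.
have nQ := near_Q_T movG e0 Sz.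
have Qz := nbhs_singleton nQ.
have Qdz := nbhs_singleton (near_Q_T movG delta0 Sz).
have nclQ : \forall y \near z, closure (Q_T T Gam eps) y.
  by apply: filterS nQ => y; exact: subset_closure.
have du := smooth_on_differentiable su nclQ.
have dp := smooth_on_differentiable sp nclQ.
have dvt := Cinfty_differentiable ext_v.1 Qdz.
have dqt := Cinfty_differentiable ext_q.1 Qdz.
have uz := expansion_value movG nuG delta0 tubG expu eps_in Sz.
have diffu := diff_expansion movG nuG delta0 tubG expu eps_in du ext_v Sz.
have diffp := diff_expansion movG nuG delta0 tubG expp eps_in dp ext_q Sz.
(* The spatial gradient of [d] is [nu], so [proj] sends each basis vector to its tangential
   projection, the direction appearing in [tgrad_diff] and [tdiv_diff]. *)
have d_axis i : 'd d z (delta_mx ord0 i, 0) = nu z ord0 i.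
  rewrite (diff_dist movG nuG VNG delta0 tubG) // mul0r subr0.
  rewrite /dot (bigD1 i) //= big1 => [|j ji].
    by rewrite mxE !eqxx mul1r addr0.
  by rewrite mxE (negPf ji) andbF mul0r.
have proj_axis i :
    'd proj z (delta_mx ord0 i, 0) = delta_mx ord0 i - nu z ord0 i *: nu z.
  by rewrite (diff_proj_dist movG nuG delta0 tubG) // d_axis.
split.
  (* The condition [v0 . nu = VN] makes the direction [(v0, 1)] tangent to the moving surface in
     space-time. *)
  have dV : 'd d z (v 0%N z, 1) = 0.
    by rewrite (diff_dist movG nuG VNG delta0 tubG) // mul1r v0n subrr.
  have pV : 'd proj z (v 0%N z, 1) = v 0%N z.
    by rewrite (diff_proj_dist movG nuG delta0 tubG) // dV scale0r subr0.
  have transportE : transport (u eps) (u eps) z = transport (v 0%N) vt z.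
    rewrite (transport_diff _ du) uz (diffu _ _ _ _ pV dV) scale0r addr0.
    exact: esym (transport_diff _ dvt).
  have gradE : grad (p eps) z = tgrad nu qt z + q 1%N z *: nu z.
    apply/rowP => i.
    rewrite (grad_diff _ dp) (diffp _ _ _ _ (proj_axis i) (d_axis i)).
    rewrite mxE (tgrad_diff _ _ dqt) mxE [in RHS]mulrC; exact: erefl.
  by rewrite -addrA -transportE -gradE momentum.
(* The [v 1] terms add up to the trace of the rank one matrix built from [nu] and [v 1], which is
   their inner product. *)
have divE : div (u eps) z = tdiv nu vt z + dot (v 1%N z) (nu z).
  rewrite (div_diff du) (tdiv_diff _ dvt) /dot -big_split /=.
  apply: eq_bigr => i _.
  have E := diffu _ _ _ _ (proj_axis i) (d_axis i).
  apply: etrans (congr1 (fun x : space R => x ord0 i) E) _.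
  rewrite mxE [X in _ + X]mxE [X in _ + X]mulrC; exact: erefl.
by move: divE; rewrite incompressible // v1n addr0.
Qed.
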